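(* Let $X$ be a Polish space, $\rho$ a diffuse locally finite measure on $X$, and $(Y_t)_{0\le t<1}$ the spatial Chinese restaurant-like process with parameter $\rho$. Let $B\subset X$ be a bounded Borel set and $t\in[0,1)$. Let $U_{B,t}$ be the random point measure on $\mathbb N$ whose weight $U_{B,t}(j)$ at $j$ is the number of points $x\in B$ with $Y_t(\{x\})=j$. Then $U_{B,t}$ is a finite Poisson process on $\mathbb N$ with intensity measure $$\rho(B)\sum_{j\ge 1}\frac{t^j}{j}\,\delta_j .$$
   Context: $\mathbb N=\{1,2,\dots\}$. $X$ is a Polish space with Borel $\sigma$-field $\mathcal B$ and ring $\mathcal B_0$ of bounded Borel sets; $\mathcal M(X)$ is the space of locally finite measures (finite on bounded sets) with the vague topology, $\mathcal M^{\cdot\cdot}(X)$ its closed subset of point measures. Pólya sum process: for $z\in[0,1)$ and $\kappa\in\mathcal M(X)$, $\mathsf S_{z,\kappa}$ denotes the unique law on $\mathcal M^{\cdot\cdot}(X)$ satisfying, for all measurable $h\ge 0$, $\iint h(x,\mu)\,\mu(\mathrm dx)\,\mathsf S_{z,\kappa}(\mathrm d\mu)=\iint h(x,\mu+\delta_x)\,z(\kappa+\mu)(\mathrm dx)\,\mathsf S_{z,\kappa}(\mathrm d\mu)$. (For $z=0$ it is the law of the zero measure.) Spatial Chinese restaurant-like process with parameter $\rho\in\mathcal M(X)$: the Markov process $(Y_t)_{0\le t<1}$ with values in $\mathcal M^{\cdot\cdot}(X)$ and càdlàg, increasing paths ($Y_s\le Y_t$ for $s\le t$) such that $Y_0=0$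 and, for $0\le s<t<1$, the conditional law of $Y_t-Y_s$ given $Y_s$ is $\mathsf S_{\frac{t-s}{1-s},\,\rho+Y_s}$. *)

(* Defs.v *)
From HB Require Import structures.
From mathcomp Require Import all_boot all_order all_algebra.
From mathcomp Require Import all_classical all_reals all_analysis.
From mathcomp Require Import measurable_realfun giry.

Set Implicit Arguments.
Unset Strict Implicit.
Unset Printing Implicit Defensive.

Import Order.TTheory GRing.Theory Num.Theory.
Import numFieldNormedType.Exports.

Local Open Scope classical_set_scope.
Local Open Scope ring_scope.

(* A Polish space is given here by a complete metric generating its topology
   together with [separable]; the metric is what "bounded set" refers to. As
   every measurable type of the library, it is pointed, hence nonempty. *)
#[short(type="completeMetricType")]
HB.structure Definition CompleteMetric (R : realType) :=
  {X of Metric R X & Complete X}.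

Definition separable (X : topologicalType) : Prop :=
  exists D : set X, countable D /\ dense D.

Definition metric_bounded (R : realType) (X : metricType R) (B : set X) : Prop :=
  exists r : R, forall x y, B x -> B y -> mdist x y <= r.

Notation borel T := (g_sigma_algebraType (@open T)).

Section locally_finite_measures.
Context (R : realType) (X : completeMetricType R).
Local Open Scope ereal_scope.

(* Measures of the library are functions on all sets, with arbitrary values on
   the nonmeasurable ones; hence measures are never compared with [=] below but
   on measurable sets ([measure_eq]). *)
Record lfmeasure := LFMeasure {
  lfm_measure :> {measure set (borel X) -> \bar R} ;
  lfm_finite : forall B : set X,
    measurable (B : set (borel X)) -> metric_bounded B -> lfm_measure B < +oo }.

HB.instance Definition _ := gen_eqMixin lfmeasure.
HB.instance Definition _ := gen_choiceMixin lfmeasure.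

Lemma lfm0_finite (B : set X) : measurable (B : set (borel X)) ->
  metric_bounded B -> (mzero : {measure set (borel X) -> \bar R}) B < +oo.
Proof. by move=> _ _; rewrite /= /mzero ltry. Qed.

Definition lfm0 : lfmeasure := LFMeasure lfm0_finite.

HB.instance Definition _ := isPointed.Build lfmeasure lfm0.

Lemma lfm_add_finite (mu nu : lfmeasure) (B : set X) :
  measurable (B : set (borel X)) -> metric_bounded B ->
  (measure_add mu nu : {measure set (borel X) -> \bar R}) B < +oo.
Proof.
move=> mB bB; rewrite [ltLHS]measure_addE.
by rewrite lte_add_pinfty//; exact: lfm_finite.
Qed.

Definition lfm_add (mu nu : lfmeasure) : lfmeasure :=
  LFMeasure (@lfm_add_finite mu nu).

Lemma lfm_dirac_finite (x : X) (B : set X) :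
  measurable (B : set (borel X)) -> metric_bounded B ->
  (dirac (x : borel X) : {measure set (borel X) -> \bar R}) B < +oo.
Proof. by move=> _ _; rewrite /= /dirac ltry. Qed.

Definition lfm_dirac (x : X) : lfmeasure := LFMeasure (@lfm_dirac_finite x).

Definition lfm_le (mu nu : lfmeasure) : Prop :=
  forall A : set (borel X), measurable A -> mu A <= nu A.

(* [nu - mu] when [lfm_le mu nu]: the solution [xi] of [mu + xi = nu], which is
   unique on measurable sets as [mu] is sigma-finite. *)
Definition lfm_sub (nu mu : lfmeasure) : lfmeasure :=
  xget lfm0 [set xi : lfmeasure | measure_eq (lfm_add mu xi) nu].

Definition point_measure (mu : lfmeasure) : Prop :=
  forall B : set X, measurable (B : set (borel X)) -> metric_bounded B ->
  exists n : nat, mu B = n%:R%:E.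

Definition diffuse (mu : lfmeasure) : Prop := forall x : X, mu [set x] = 0.

Definition test_function :=
  {f : X -> R | [/\ continuous f,
     exists M : R, forall x, (`|f x| <= M)%R &
     metric_bounded [set x | f x != 0%R]]}.

Definition lfm_pairing (mu : lfmeasure) : {ptws test_function -> R} :=
  fun f => Rintegral mu setT (sval f).

(* the vague topology *)
HB.instance Definition _ :=
  Topological.copy lfmeasure (initial_topology lfm_pairing).

End locally_finite_measures.

Section laws.
Context (R : realType) (X : completeMetricType R).
Local Open Scope ereal_scope.
Local Notation M := (lfmeasure X).

(* [Q] is the law of the Polya sum process with parameters [z] and [kappa] *)
Definition polya_sum_law (z : R) (kappa : M)
    (Q : {measure set (borel M) -> \bar R}) : Prop :=
  [/\ Q setT = 1,
      {ae Q, forall mu : borel M, point_measure (mu : M)} &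
      forall h : borel X * borel M -> \bar R,
        measurable_fun setT h -> (forall p, 0 <= h p) ->
        \int[Q]_mu \int[(mu : M)]_x h (x, mu) =
        \int[Q]_mu (z%:E *
          \int[lfm_add kappa mu]_x h (x, lfm_add mu (lfm_dirac x)))].

End laws.

Section conditioning.
Context (R : realType) (d d1 d2 : measure_display) (Omega : measurableType d)
  (S1 : measurableType d1) (S2 : measurableType d2) (P : probability Omega R).
Local Open Scope ereal_scope.

(* [K (W w)] is a version of the conditional law of [Z] given [W] *)
Definition conditional_law (W : Omega -> S1) (Z : Omega -> S2)
    (K : R.-pker S1 ~> S2) : Prop :=
  forall (D : set S1) (A : set S2), measurable D -> measurable A ->
  P (W @^-1` D `&` Z @^-1` A) = \int[P]_(w in W @^-1` D) K (W w) A.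

End conditioning.

Section processes.
Context (R : realType) (X : completeMetricType R) (d : measure_display)
  (Omega : measurableType d) (P : probability Omega R).
Local Open Scope ereal_scope.
Local Notation M := (lfmeasure X).
Implicit Type Y : R -> Omega -> M.

Definition past Y (s : R) : set (set Omega) :=
  <<s \bigcup_(u in `[0%R, s]) preimage_set_system setT (Y u : Omega -> borel M)
        measurable >>.

(* The conditional probability of [Y t \in A] given the past of [s] has a
   version which is a function of [Y s]. *)
Definition markov_process Y : Prop :=
  forall s t : R, (0 <= s)%R -> (s <= t)%R -> (t < 1)%R ->
  forall A : set (borel M), measurable A ->
  exists g : borel M -> \bar R,
    [/\ measurable_fun setT g, forall mu, 0 <= g mu &
        forall E, past Y s E ->
          P (E `&` Y t @^-1` A) = \int[P]_(w in E) g (Y s w)].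

Definition cadlag (y : R -> M) : Prop :=
  (forall t : R, (0 <= t)%R -> (t < 1)%R -> y s @[s --> t^'+] --> y t) /\
  (forall t : R, (0 < t)%R -> (t < 1)%R -> cvg (y s @[s --> t^'-])).

(* [Y t] is only meaningful for [0 <= t < 1]. *)
Record spatial_crp (rho : M) Y : Prop := SpatialCRP {
  crp_measurable : forall t, (0 <= t)%R -> (t < 1)%R ->
    measurable_fun setT (Y t : Omega -> borel M) ;
  crp_point : forall t w, (0 <= t)%R -> (t < 1)%R -> point_measure (Y t w) ;
  crp_cadlag : forall w, cadlag (Y ^~ w) ;
  crp_increasing : forall s t w, (0 <= s)%R -> (s <= t)%R -> (t < 1)%R ->
    lfm_le (Y s w) (Y t w) ;
  crp_markov : markov_process Y ;
  crp_init : {ae P, forall w, measure_eq (Y 0%R w) (lfm0 X)} ;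
  crp_increment : forall s t : R, (0 <= s)%R -> (s < t)%R -> (t < 1)%R ->
    exists K : R.-pker (borel M) ~> (borel M),
      (forall mu : M, point_measure mu ->
        polya_sum_law ((t - s) / (1 - s)) (lfm_add rho mu) (K mu)) /\
      conditional_law P (Y s : Omega -> borel M)
        (fun w => lfm_sub (Y t w) (Y s w) : borel M) K }.

End processes.

(* Point processes on {1,2,...} are taken on [nat], without mass at 0. *)
Section atomic_measures.
Context (R : realType).
Local Open Scope ereal_scope.

Section atoms.
Variables (w : nat -> \bar R) (w_ge0 : forall j, 0 <= w j).

(* the measure \sum_(j >= 1) w j *: \d_j *)
Definition atoms of (forall j, 0 <= w j) := fun A : set nat =>
  \esum_(j in A `&` [set j | (0 < j)%N]) w j.

Let atoms0 : atoms w_ge0 set0 = 0.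
Proof. by rewrite /atoms set0I esum_set0. Qed.

Let atoms_ge0 A : 0 <= atoms w_ge0 A.
Proof. by apply: esum_ge0 => j _; exact: w_ge0. Qed.

Let atoms_sigma_additive : semi_sigma_additive (atoms w_ge0).
Proof.
move=> F mF tF mUF; rewrite /atoms setI_bigcupl nneseries_sum_bigcup//.
  by apply: is_cvg_nneseries => n _ _; exact: atoms_ge0.
apply/trivIsetP => i j _ _ ij; rewrite setIACA (_ : F i `&` F j = set0) ?set0I//.
by move/trivIsetP : tF; exact.
Qed.

HB.instance Definition _ := isMeasure.Build _ _ _ (atoms w_ge0)
  atoms0 atoms_ge0 atoms_sigma_additive.

End atoms.

Variable X : completeMetricType R.
Implicit Types (mu : lfmeasure X) (B : set X).

Definition number_of_atoms mu B (j : nat) : \bar R :=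
  counting [set x : X | B x /\ mu [set x] = j%:R%:E].

Lemma number_of_atoms_ge0 mu B j : 0 <= number_of_atoms mu B j.
Proof.
by rewrite /number_of_atoms /counting; case: ifP => _; rewrite ?lee_fin ?leey.
Qed.

Definition multiplicities mu B : {measure set nat -> \bar R} :=
  atoms (number_of_atoms_ge0 mu B).

Lemma crp_weight_ge0 mu B (t : R) (t_ge0 : (0 <= t)%R) (j : nat) :
  0 <= mu B * (t ^+ j / j%:R)%:E.
Proof. by rewrite mule_ge0// lee_fin divr_ge0// exprn_ge0. Qed.

(* mu B *: \sum_(j >= 1) t ^+ j / j%:R *: \d_j *)
Definition crp_intensity mu B (t : R) (t_ge0 : (0 <= t)%R) :
    {measure set nat -> \bar R} :=
  atoms (crp_weight_ge0 mu B t_ge0).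

End atomic_measures.

Section poisson.
Context (R : realType) (d d' : measure_display) (Omega : measurableType d)
  (E : measurableType d') (P : probability Omega R).
Local Open Scope ereal_scope.

(* [poisson_pmf] of the library is not a probability mass function at rate 0,
   so the weights are written out. Since all [N w A] are natural numbers, the
   product rule on singletons is independence. *)
Definition finite_poisson_process (N : Omega -> {measure set E -> \bar R})
    (lambda : {measure set E -> \bar R}) : Prop :=
  [/\ lambda setT < +oo,
      forall w (A : set E), measurable A -> exists n : nat, N w A = n%:R%:E,
      forall A : set E, measurable A -> measurable_fun setT (fun w => N w A),
      forall (A : set E) (k : nat), measurable A ->
        let r := fine (lambda A) in
        P [set w | N w A = k%:R%:E] = (r ^+ k / k`!%:R * expR (- r))%:E &
      forall (n : nat) (A : 'I_n -> set E) (k : 'I_n -> nat),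
        (forall i, measurable (A i)) -> trivIset setT A ->
        P (\bigcap_(i in setT) [set w | N w (A i) = (k i)%:R%:E]) =
        \prod_(i < n) P [set w | N w (A i) = (k i)%:R%:E]].

End poisson.

(* Main.v *)
Require Import Defs.
From HB Require Import structures.
From mathcomp Require Import all_boot all_order all_algebra.
From mathcomp Require Import finmap.
From mathcomp Require Import all_classical all_reals all_analysis.
From mathcomp Require Import measurable_realfun giry.
From mathcomp Require Import ring lra zify.

Set Implicit Arguments.
Unset Strict Implicit.
Unset Printing Implicit Defensive.

Import Order.TTheory GRing.Theory Num.Theory.
Import numFieldNormedType.Exports.

Local Open Scope classical_set_scope.
Local Open Scope ring_scope.

(** For A a set of positive integers, let N(A) count the points x of B whose mass
    under Y_t is an integer of A, and let n_j = N({j}). The process starts from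
    the zero measure, so Y_t has the law of the Polya sum process with parameters
    t and rho, and the proof uses nothing but the integral equation of that law.

    Apply the equation to the indicator of x in B, mu{x} = j, mu in E, where E is
    an event that depends on the counts only. On the right-hand side the point x
    has mass j - 1 and receives one more unit. As rho is diffuse, it charges only
    points without mass, so a new point of mass 1 arises at rate t rho(B), while
    mu charges each point of mass j - 1 exactly j - 1 times. Hence
      E[n_1; E] = t rho(B) P(E'),   j E[n_j; E] = t (j - 1) E[n_(j-1); E'],
    where E' is the event E read after the growth of that point. Induction on j
    gives, in [mecke_counts],
      E[n_j; E] = rho(B) t^j/j P(E^j),
    where E^j is E read after the addition of a point of mass j. This is the Mecke
    equation of the Poisson process on the positive integers with intensity
    lambda = rho(B) sum_j t^j/j delta_j, and it determines the law of the counts: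
    for E = {N(A_1) = k, N(A_2) = k_2, ...} with A_1 disjoint from the other sets,
    summing over j in A_1 yields
      k P(N(A_1) = k, ...) = lambda(A_1) P(N(A_1) = k - 1, ...),
    so that N(A_1) has Poisson weights and is independent of the remaining counts
    ([counts_eq_cons_poisson]).

    The rest makes this rigorous for the Borel sets of the vague topology: the
    map (x, mu) |-> mu{x} is jointly measurable ([measurable_point_mass]), integer
    valued measures on a separable space have no diffuse part
    ([point_measure_diffuse_part], needed for j = 1, where points without mass
    must not be charged by mu), and the conditional law of Y_t - Y_0 given Y_0 is
    the law of Y_t ([crp_law]). *)

(** * Borel sets and the distance to a complement *)

Section borel_sets.
Context (R : realType).

Lemma open_borel (T : ptopologicalType) (U : set T) :
  open U -> measurable (U : set (borel T)).
Proof. by move=> oU; exact: sub_sigma_algebra. Qed.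

Lemma continuous_borel_measurable (T : ptopologicalType) (f : T -> R) :
  continuous f -> measurable_fun setT (f : borel T -> R).
Proof.
move=> /continuousP cf; apply: (measurability _ (RGenOpens.measurableE R)).
move=> _ [_ [a [b ->] <-]]; rewrite setTI.
by apply: open_borel; apply: cf; exact: interval_open.
Qed.

End borel_sets.

Section distance_to_complement.
Context (R : realType) (X : completeMetricType R).
Implicit Types (W : set X) (x y : X).

(** The distance from [x] to the complement of [W], truncated at 1 so that the
    infimum is over a nonempty set even when [W] is the whole space. *)
Definition gap W x : R := inf ([set 1] `|` [set mdist x a | a in ~` W]).

Let gap_has_inf W x : has_inf ([set 1] `|` [set mdist x a | a in ~` W]).
Proof.
split; first by exists 1; left.
by exists 0 => _ [->//|[a _ <-]]; exact: mdist_ge0.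
Qed.

Lemma gap_ge0 W x : 0 <= gap W x.
Proof.
apply: lb_le_inf; first by exists 1; left.
by move=> _ [->//|[a _ <-]]; exact: mdist_ge0.
Qed.

Lemma gap_le_mdist W x a : ~ W a -> gap W x <= mdist x a.
Proof. by move=> Wa; apply: ge_inf; [case: (gap_has_inf W x)|right; exists a]. Qed.

Lemma gap_eq0 W x : ~ W x -> gap W x = 0.
Proof.
move=> Wx; apply/eqP; rewrite eq_le gap_ge0 andbT.
by rewrite (le_trans (gap_le_mdist _ Wx))// mdistxx.
Qed.

Lemma gap_gt0 W x : open W -> W x -> 0 < gap W x.
Proof.
move=> oW Wx; have /nbhs_ballP[/= e e0] := open_nbhs_nbhs (conj oW Wx).
rewrite ballEmdist => eW.
apply: (@lt_le_trans _ _ (Num.min 1 e)); first by rewrite lt_min ltr01.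
apply: lb_le_inf; first by exists 1; left.
move=> _ [->|[a Wa <-]]; first by rewrite ge_min lexx.
by rewrite ge_min orbC leNgt; case: ltP => // /eW.
Qed.

Lemma gap_lipschitz W x y : gap W x <= mdist x y + gap W y.
Proof.
rewrite -lerBlDl; apply: lb_le_inf; first by exists 1; left.
move=> _ [->|[a Wa <-]].
  rewrite lerBlDl (@le_trans _ _ 1)//; last by rewrite lerDr mdist_ge0.
  by apply: ge_inf; [case: (gap_has_inf W x)|left].
by rewrite lerBlDl (le_trans (gap_le_mdist _ Wa))// metric_triangle.
Qed.

Lemma continuous_gap W : continuous (gap W).
Proof.
move=> x; apply/cvgrPdist_lt => e e0; apply/nbhs_ballP; exists e => //= y.
rewrite ballEmdist /= => xy.
rewrite ltr_norml; have := gap_lipschitz W x y; have := gap_lipschitz W y x.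
by rewrite (metric_sym y x); lra.
Qed.

End distance_to_complement.

(** * The mass of a Borel set is a measurable function of the measure *)

Section measurability_of_evaluations.
Context (R : realType) (X : completeMetricType R).
Local Open Scope ereal_scope.
Local Notation M := (lfmeasure X).
Implicit Types (B W : set X) (mu : M).

Lemma metric_boundedS B W : W `<=` B -> metric_bounded B -> metric_bounded W.
Proof. by move=> WB [r rB]; exists r => x y /WB Bx /WB By; exact: rB. Qed.

Lemma measurable_pairing (f : test_function X) :
  measurable_fun setT (fun mu : borel M => lfm_pairing (mu : M) f).
Proof.
apply: continuous_borel_measurable => mu.
apply: (@continuous_comp _ _ _ (@lfm_pairing R X)
  (fun g : {ptws test_function X -> R} => g f)).
  exact: initial_continuous.
have /cvg_sup/(_ f) h : nbhs (lfm_pairing mu) --> lfm_pairing mu by exact: cvg_id.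
apply: cvg_trans (cvg_app (fun g : {ptws test_function X -> R} => g f) h) _.
exact: (@initial_continuous _ _ (fun g : test_function X -> R => g f)
  (lfm_pairing mu)).
Qed.

Lemma integral_pairing (f : test_function X) mu :
  (forall x, 0 <= sval f x)%R ->
  (lfm_pairing mu f)%:E = \int[mu]_x (sval f x)%:E.
Proof.
move=> f0; case: f f0 => /= f [cf [r rf] bf] f0.
rewrite /lfm_pairing/= /Rintegral fineK//.
have mf : measurable_fun setT (f : borel X -> R).
  exact: continuous_borel_measurable.
have mS : measurable ([set x | f x != 0%R] : set (borel X)).
  rewrite (_ : mkset _ = f @^-1` (~` [set 0%R])); last first.
    by apply/seteqP; split => x /= /eqP.
  rewrite -[X in measurable X]setTI; apply: mf => //; exact: measurableC.
rewrite ge0_fin_numE; last by apply: integral_ge0 => x _; rewrite lee_fin.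
apply: (@le_lt_trans _ _ (\int[mu]_x (`|r| * \1_[set x | f x != 0%R] x)%:E)).
  apply: ge0_le_integral => //.
  - by move=> x _; rewrite lee_fin.
  - exact/measurable_EFinP.
  - by apply/measurable_EFinP; apply: measurable_funM => //; exact: measurable_indic.
  move=> x _; rewrite lee_fin indicE; case: (eqVneq (f x) 0%R) => [->|fx0].
    by rewrite mulr_ge0.
  rewrite mem_set//= mulr1 (le_trans (ler_norm _))// (le_trans (rf x))//.
  exact: ler_norm.
under eq_integral do rewrite EFinM.
rewrite ge0_integralZl//; last first.
  by apply/measurable_EFinP; exact: measurable_indic.
rewrite integral_indic// setIT; apply: lte_mul_pinfty => //.
exact: lfm_finite.
Qed.

(** The indicator of [W] is the increasing limit of the test functions
    min(1, n gap W), so mu(W) is a limit of vaguely continuous functions of mu. *)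
Lemma measurable_lfm_open W : open W -> metric_bounded W ->
  measurable_fun setT (fun mu : borel M => (mu : M) W).
Proof.
move=> oW bW.
pose f n x : R := Num.min 1%R (n%:R * gap W x)%R.
have f0 n x : (0 <= f n x)%R by rewrite le_min ler01 mulr_ge0// gap_ge0.
have cf n : continuous (f n).
  move=> x; apply: (@continuous_min _ _ (fun=> 1%R) (fun x => n%:R * gap W x)%R).
    exact: cvg_cst.
  apply: cvgM; [exact: cvg_cst|exact: continuous_gap].
have tf n : [/\ continuous (f n),
    exists r : R, forall x, (`|f n x| <= r)%R &
    metric_bounded [set x | f n x != 0%R]].
  split; first exact: cf.
  - by exists 1%R => x; rewrite ger0_norm// ge_min lexx.
  - apply: metric_boundedS bW => x /=; apply: contra_neqP => /gap_eq0.
    by rewrite /f => ->; rewrite mulr0; apply/min_idPr.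
apply: (@emeasurable_fun_cvg _ _ _ _
    (fun n (mu : borel M) => (lfm_pairing (mu : M) (exist _ _ (tf n)))%:E)).
  by move=> n; apply/measurable_EFinP; exact: measurable_pairing.
move=> mu _.
under eq_cvg do rewrite integral_pairing//=.
have -> : (mu : M) W = \int[(mu : M)]_x (\1_W x)%:E.
  by rewrite integral_indic// ?setIT//; exact: open_borel.
have mf n : measurable_fun setT (fun x : borel X => (f n x)%:E).
  by apply/measurable_EFinP; apply: continuous_borel_measurable; exact: cf.
have nf (x : X) : nondecreasing_seq (fun n => (f n x)%:E).
  move=> m n mn; rewrite lee_fin /f le_min ge_min lexx/=.
  by rewrite ge_min ler_wpM2r ?orbT ?gap_ge0// ler_nat.
have fW (x : X) : (f n x)%:E @[n --> \oo] --> (\1_W x)%:E.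
  apply: cvg_EFin; first by near=> n.
  apply: cvg_near_cst; rewrite indicE; have [Wx|Wx] := pselect (W x).
    near=> n; rewrite mem_set//; apply/min_idPl.
    rewrite -ler_pdivrMr ?gap_gt0//.
    by near: n; exact: nbhs_infty_ger.
  near=> n; rewrite memNset// /f gap_eq0//= mulr0; apply/min_idPr.
  exact: ler01.
have := @cvg_monotone_convergence _ _ _ (mu : M) setT measurableT
  (fun n x => (f n x)%:E) (fun n => mf n) (fun n x _ => f0 n x) (fun x _ => nf x).
rewrite (_ : \int[_]_(x in _) _ = \int[(mu : M)]_x (\1_W x)%:E)//.
by apply: eq_integral => x _; apply/cvg_lim => //; exact: fW.
Unshelve. all: by end_near. Qed.

End measurability_of_evaluations.

Section evaluation_kernel.
Context (R : realType) (X : completeMetricType R).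
Local Open Scope ereal_scope.
Local Notation M := (lfmeasure X).
Implicit Types (A B : set X) (mu : M).

Lemma open_ball (x : X) (r : R) : open (ball x r).
Proof.
rewrite openE => y; rewrite ballEmdist/= => xy; apply/nbhs_ballP.
exists (r - mdist x y)%R => /=; first by rewrite subr_gt0.
move=> z; rewrite !ballEmdist/= => yz.
by rewrite (le_lt_trans (metric_triangle x y z))// -ltrBrDl.
Qed.

Lemma borel_ball (x : X) (r : R) : measurable (ball x r : set (borel X)).
Proof.
by apply: open_borel; exact: open_ball.
Qed.

Lemma metric_bounded_ball (x : X) (r : R) : metric_bounded (ball x r).
Proof.
exists (r + r)%R => y z; rewrite !ballEmdist/= => xy xz.
rewrite (le_trans (metric_triangle y x z))// (metric_sym y x).
by rewrite lerD// ltW.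
Qed.

Lemma lfm_ball_fin_num mu (x : X) (r : R) A :
  measurable (A : set (borel X)) -> mu (A `&` ball x r) \is a fin_num.
Proof.
move=> mA; rewrite ge0_fin_numE//; apply: lfm_finite.
  by apply: measurableI => //; exact: borel_ball.
by apply: metric_boundedS (metric_bounded_ball x r) => y [].
Qed.

(** A Dynkin class argument, with the open sets as generating pi-system; the
    intersection with a ball keeps masses finite, as complements require. *)
Lemma measurable_lfm_ball (x : X) (r : R) A : measurable (A : set (borel X)) ->
  measurable_fun setT (fun mu : borel M => (mu : M) (A `&` ball x r)).
Proof.
have mb := borel_ball x r.
pose P A := measurable_fun setT (fun mu : borel M => (mu : M) (A `&` ball x r)).
have openP (U : set X) : open U -> P U.
  move=> oU; apply: measurable_lfm_open; first by apply: openI => //; exact: open_ball.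
  by apply: metric_boundedS (metric_bounded_ball x r) => y [].
apply: (@dynkin_induction _ (borel X) open P) => //.
- by move=> U V; exact: openI.
- by apply: openP; exact: openT.
- move=> S mS PS; rewrite /P (_ : (fun _ => _) = fun mu : borel M =>
      (mu : M) (setT `&` ball x r) - (mu : M) (S `&` ball x r)).
    by apply: emeasurable_funB => //; apply: openP; exact: openT.
  apply/funext => mu; rewrite setTI setIC -setDE measureD//.
    by rewrite setIC.
  have := lfm_ball_fin_num mu x r (@measurableT _ (borel X)).
  by rewrite setTI ge0_fin_numE.
- move=> F mF tF PF; rewrite /P (_ : (fun _ => _) = fun mu : borel M =>
      \sum_(n <oo) (mu : M) (F n `&` ball x r)).
    apply: (@ge0_emeasurable_sum _ _ _ _
      (fun n (mu : borel M) => (mu : M) (F n `&` ball x r)) xpredT) => // n _.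
    exact: PF.
  apply/funext => mu; rewrite setI_bigcupl measure_bigcup//.
  + by apply: eq_eseriesl => n; rewrite in_setT.
  + by move=> n _; exact: measurableI.
  + exact: trivIset_setIr.
Qed.

Lemma bigcup_ball (x : X) : \bigcup_n ball x n%:R = setT.
Proof.
apply/seteqP; split => // y _; exists (Num.truncn (mdist x y)).+1 => //.
by rewrite ballEmdist/= truncnS_gt.
Qed.

Lemma measurable_lfm A : measurable (A : set (borel X)) ->
  measurable_fun setT (fun mu : borel M => (mu : M) A).
Proof.
move=> mA; apply: (@emeasurable_fun_cvg _ _ _ _
    (fun n (mu : borel M) => (mu : M) (A `&` ball (point : X) n%:R))).
  by move=> n; exact: measurable_lfm_ball.
move=> mu _; rewrite -[X in _ --> _ X]setIT -(bigcup_ball point) setI_bigcupr.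
apply: nondecreasing_cvg_mu.
- by move=> n; apply: measurableI => //; exact: borel_ball.
- by apply: bigcup_measurable => n _; apply: measurableI => //; exact: borel_ball.
- move=> m n mn; apply/subsetPset; apply: setIS; apply: le_ball.
  by rewrite ler_nat.
Qed.

(** The identity, seen as a kernel from measures to points: this gives access to
    the measurability of sections of jointly measurable sets. *)
Definition eval_kernel (mu : borel M) : {measure set (borel X) -> \bar R} := mu : M.

Lemma measurable_eval_kernel (U : set (borel X)) : measurable U ->
  measurable_fun setT (eval_kernel ^~ U).
Proof. exact: measurable_lfm. Qed.

HB.instance Definition _ :=
  isKernel.Build _ _ (borel M) (borel X) R eval_kernel measurable_eval_kernel.

Lemma measurable_lfm_section (C : set (borel X * borel M)) B :
  measurable C -> measurable (B : set (borel X)) -> metric_bounded B ->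
  measurable_fun setT (fun mu : borel M => (mu : M) (ysection C mu `&` B)).
Proof.
move=> mC mB bB.
pose C' : set (borel M * borel X) := (fun p => (p.2, p.1)) @^-1` C.
have mC' : measurable C'.
  rewrite -[C']setTI; apply: (measurable_fun_pair measurable_snd measurable_fst) => //.
have [|_] := @measurable_prod_subset_xsection_kernel _ _ _ _ R eval_kernel _ mB _ C' mC'.
  move=> mu; exists (fine ((mu : M) B) + 1)%R => A mA.
  apply: (@le_lt_trans _ _ ((mu : M) B)).
    by rewrite /mrestr le_measure ?inE//; exact: measurableI.
  rewrite EFinD fineK ?lteDl// ge0_fin_numE//; exact: lfm_finite.
by [].
Qed.

End evaluation_kernel.

(** * Point masses on a separable space *)

Section point_masses.
Context (R : realType) (X : completeMetricType R).
Local Open Scope ereal_scope.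
Local Notation M := (lfmeasure X).
Implicit Types (A B : set X) (mu : M).

Lemma dense_sequence : separable X ->
  exists u : nat -> X, forall (x : X) (e : R), (0 < e)%R ->
    exists n, (mdist x (u n) < e)%R.
Proof.
move=> [D [/countable_injP[f injf] dD]].
exists (fun n => xget point [set x | D x /\ f x = n]) => x e e0.
have [|y [xy Dy]] := dD (ball x e) _ (open_ball x e).
  by exists x; rewrite ballEmdist/= mdistxx.
exists (f y); rewrite ballEmdist/= in xy.
case: xgetP => [z _ [Dz fzy]|/(_ y)[]//].
by rewrite (injf z y)// inE.
Qed.

Lemma bigcap_ball (x : X) : \bigcap_k ball x k.+1%:R^-1 = [set x].
Proof.
apply/seteqP; split => [y xy|_ -> k _]; last by rewrite ballEmdist/= mdistxx.
apply: contrapT => /eqP; rewrite eq_sym -mdist_gt0 => d0.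
have [k _] := near_infty_natSinv_lt (PosNum d0).
move=> /(_ k (leqnn k))/=; have := xy k I; rewrite ballEmdist/=.
by move=> /lt_trans/[apply]; rewrite ltxx.
Qed.

Lemma borel_set1 (x : X) : measurable ([set x] : set (borel X)).
Proof.
rewrite -bigcap_ball; apply: bigcap_measurable; first by exists 0%N.
by move=> k _; exact: borel_ball.
Qed.

Lemma ball_mass_lt mu (x : X) (c : \bar R) : mu [set x] < c ->
  exists k : nat, mu (ball x k.+1%:R^-1) < c.
Proof.
move=> xc; have mb k : measurable (ball x k.+1%:R^-1 : set (borel X)).
  exact: borel_ball.
have : mu (ball x k.+1%:R^-1) @[k --> \oo] --> mu [set x].
  rewrite -bigcap_ball; apply: nonincreasing_cvg_mu => //.
  - by apply: lfm_finite => //; exact: metric_bounded_ball.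
  - by rewrite bigcap_ball; exact: borel_set1.
  - move=> m n mn; apply/subsetPset; apply: le_ball.
    by rewrite lef_pV2 ?posrE// ler_nat.
move=> /(_ [set y | y < c])[|k _ kc].
  by apply: open_nbhs_nbhs; split => //; exact: open_ereal_lt_ereal.
by exists k; exact: (kc k (leqnn k)).
Qed.

Section separable.
Hypothesis sepX : separable X.

Let u : nat -> X := sval (cid (dense_sequence sepX)).

Let denseu : forall (x : X) (e : R), (0 < e)%R ->
  exists n, (mdist x (u n) < e)%R.
Proof. exact: svalP (cid (dense_sequence sepX)). Qed.

Let base (p : nat * nat) : set X := ball (u p.1) p.2.+1%:R^-1.

(** Point masses are read off a countable base: by continuity from above some
    ball around [x] has mass below [c], and it contains a smaller ball of the base
    around [x]. *)
Let base_mass_lt mu (x : X) (c : \bar R) :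
  mu [set x] < c <-> exists p, base p x /\ mu (base p) < c.
Proof.
split=> [/ball_mass_lt[k kc]|[p [px]]]; last first.
  apply: le_lt_trans; apply: le_measure; rewrite ?inE.
  - exact: borel_set1.
  - exact: borel_ball.
  - by move=> _ ->.
(* half the radius 1 / k.+1, so that the ball around u n stays in that around x *)
have k0 : (0 < (k.*2.+1).+1%:R^-1 :> R)%R by rewrite invr_gt0.
have [n xn] := denseu x k0.
exists (n, k.*2.+1); split; first by rewrite /base ballEmdist/= metric_sym.
apply: le_lt_trans kc; apply: le_measure; rewrite ?inE; try exact: borel_ball.
move=> y; rewrite /base !ballEmdist/= => uy.
rewrite (le_lt_trans (metric_triangle x (u n) y))//.
have -> : (k.+1%:R^-1 = (k.*2.+1).+1%:R^-1 + (k.*2.+1).+1%:R^-1 :> R)%R.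
  by rewrite -doubleS -muln2 natrM invfM -splitr.
by rewrite ltrD.
Qed.

Lemma measurable_point_mass :
  measurable_fun setT (fun p : borel X * borel M => (p.2 : M) [set p.1]).
Proof.
apply: (measurability _ (ErealGenCInfty.measurableE R)).
move=> _ [_ [c ->] <-]; rewrite setTI.
rewrite (_ : _ @^-1` _ = ~` \bigcup_p
    (base p `*` [set mu : borel M | (mu : M) (base p) < c%:E])); last first.
  apply/seteqP; split => -[x mu]/=; rewrite in_itv/= andbT leNgt.
    by move=> /negP + [p _ [px pc]]; apply; apply/base_mass_lt; exists p.
  move=> h; apply/negP => /base_mass_lt[p [px pc]].
  by apply: h; exists p.
apply: measurableC.
apply: countable_bigcupT_measurable => // p; apply: measurableX; first exact: borel_ball.
have := @measurable_lfm R X _ (borel_ball (u p.1) p.2.+1%:R^-1) measurableT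
  _ (emeasurable_itv `]-oo, c%:E[).
by rewrite setTI; congr measurable; apply/seteqP; split => mu/=; rewrite in_itv.
Qed.

(** A point without mass lies in a ball of the countable base of mass less than
    1, that is, of mass 0 since masses are integers; hence such points are covered
    by countably many null balls. *)
Lemma point_measure_diffuse_part mu B : point_measure mu ->
  measurable (B : set (borel X)) -> B `<=` [set x | mu [set x] = 0] -> mu B = 0.
Proof.
move=> pmu mB B0.
pose V p : set X := if mu (base p) == 0 then base p else set0.
have mV p : measurable (V p : set (borel X)).
  by rewrite /V; case: ifP => // _; exact: borel_ball.
have BV : B `<=` \bigcup_n \bigcup_m V (n, m).
  move=> x /B0 x0.
  have /base_mass_lt[[n m] [px p1]] : mu [set x] < 1 by rewrite x0.
  exists n => //; exists m => //; rewrite /V ifT//.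
  have [k n0] := pmu _ (borel_ball (u n) m.+1%:R^-1) (metric_bounded_ball _ _).
  move: p1; rewrite [X in X < _]n0 lte_fin ltrn1 ltnS leqn0 => /eqP k0.
  by rewrite [X in X == _]n0 k0.
suff : mu.-negligible B by move/negligibleP => /(_ mB).
apply: (@negligibleS _ (borel X) R mu _ _ BV).
apply: negligible_bigcup => n; apply: negligible_bigcup => m.
by apply/negligibleP => //; rewrite /V; case: ifPn => [/eqP//|_]; rewrite measure0.
Qed.

End separable.
End point_masses.

(** * Counting the atoms of each multiplicity *)

Section level_sets.
Context (R : realType) (X : completeMetricType R).
Local Open Scope ereal_scope.
Local Notation M := (lfmeasure X).
Hypothesis sepX : separable X.
Variable B : set X.
Hypotheses (mB : measurable (B : set (borel X))) (bB : metric_bounded B).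
Implicit Types (A : set nat) (mu : M) (j : nat).

Definition level mu j : set X := [set x | B x /\ mu [set x] = j%:R%:E].

Definition atoms_with mu A : set X :=
  \bigcup_(j in A `&` [set j | (0 < j)%N]) level mu j.

Definition natoms mu A : nat := #|` fset_set (atoms_with mu A)|.

Lemma measurable_level_graph j :
  measurable [set p : borel X * borel M | level p.2 j p.1].
Proof.
rewrite (_ : mkset _ = (B `*` setT) `&`
    (setT `&` (fun p : borel X * borel M => (p.2 : M) [set p.1])
       @^-1` [set j%:R%:E])).
  apply: measurableI; first exact: measurableX.
  by apply: (measurable_point_mass sepX) => //; exact: emeasurable_set1.
by apply/seteqP; split => -[x mu]/=; [move=> [? ?]|move=> [[? _] [_ ?]]].
Qed.

Lemma measurable_level mu j : measurable (level mu j : set (borel X)).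
Proof.
have := measurable_ysection (mu : borel M) (measurable_level_graph j).
by congr measurable; apply/seteqP; split => x; rewrite ysectionE.
Qed.

Lemma trivIset_level mu A : trivIset A (level mu).
Proof.
move=> i j _ _ [x [[_ xi] [_]]]; rewrite xi => -[/eqP].
by rewrite eqr_nat => /eqP.
Qed.

Lemma lfm_fset mu (F : {fset X}) :
  mu [set` F] = \sum_(x <- F) mu [set x].
Proof.
rewrite -(@measure_fbigsetU _ R (borel X) mu X F (fun x => [set x])).
- rewrite -bigcup_fset; congr (mu _).
  by apply/seteqP; split => [x xF|_ [x xF ->]//]; exists x.
- by move=> x _; exact: borel_set1.
- by move=> x y _ _ [z [-> ->]].
Qed.

Lemma finite_heavy_points mu (e : R) : (0 < e)%R ->
  finite_set [set x | B x /\ e%:E <= mu [set x]].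
Proof.
move=> e0; apply: contrapT => infA.
have muB : mu B \is a fin_num by rewrite ge0_fin_numE//; exact: lfm_finite.
(* more than mu(B) / e points of mass at least e exceed the finite mass of B *)
have [F FA nF] := infinite_set_fset (Num.truncn (fine (mu B) / e)).+1 infA.
have : mu [set` F] <= mu B.
  apply: le_measure; rewrite ?inE//.
    apply: countable_measurable; first exact: borel_set1.
    by apply: finite_set_countable; exact: finite_fset.
  by move=> x /FA[].
rewrite leNgt => /negP; apply; rewrite lfm_fset.
apply: (@lt_le_trans _ _ (\sum_(x <- F) e%:E)).
  rewrite sumEFin -(fineK muB) lte_fin big_const_seq count_predT iter_addr_0.
  rewrite -mulr_natr mulrC -ltr_pdivrMr//.
  by apply: (lt_le_trans (truncnS_gt _)); rewrite ler_nat.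
by rewrite big_seq [leRHS]big_seq; apply: lee_sum => x /FA[].
Qed.

Lemma finite_atoms_with mu A : finite_set (atoms_with mu A).
Proof.
apply: sub_finite_set (finite_heavy_points mu (@ltr01 R)) => x [j [_ /= j0] [Bx ->]].
by split => //; rewrite lee_fin ler1n.
Qed.

Lemma level_atoms_with mu j : (0 < j)%N -> level mu j = atoms_with mu [set j].
Proof.
move=> j0; apply/seteqP; split => [x xj|x [_ [->]]//].
by exists j.
Qed.

Lemma finite_level mu j : (0 < j)%N -> finite_set (level mu j).
Proof. by move=> j0; rewrite level_atoms_with//; exact: finite_atoms_with. Qed.

(** This turns the number of atoms, defined by counting points, into a mass, which
    depends measurably on the measure. *)
Lemma lfm_level mu j : (0 < j)%N ->
  mu (level mu j) = j%:R%:E * number_of_atoms mu B j.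
Proof.
move=> j0; have fl := finite_level mu j0.
rewrite /number_of_atoms /counting -/(level mu j) asboolT//.
rewrite -[in LHS](fset_setK fl) lfm_fset.
rewrite big_seq (eq_bigr (fun=> j%:R%:E)); last first.
  by move=> x; rewrite in_fset_set// inE => -[].
rewrite -big_seq sumEFin -EFinM; congr EFin.
by rewrite big_const_seq count_predT iter_addr_0 mulr_natr.
Qed.

Lemma multiplicitiesE mu A : multiplicities mu B A = (natoms mu A)%:R%:E.
Proof.
transitivity (@counting X R (atoms_with mu A)); last first.
  by rewrite /counting asboolT//; exact: finite_atoms_with.
rewrite (@measure_bigcup _ R (borel X) (@counting X R) (A `&` [set j | (0 < j)%N])).
- rewrite nneseries_esum; last by move=> j _; exact: number_of_atoms_ge0.
  by rewrite set_mem_set.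
- by move=> j _; exact: measurable_level.
- exact: trivIset_level.
Qed.

Lemma measurable_number_of_atoms j : (0 < j)%N ->
  measurable_fun setT (fun mu : borel M => number_of_atoms (mu : M) B j).
Proof.
move=> j0.
have := @measurable_lfm_section R X _ B (measurable_level_graph j) mB bB.
move=> /(measurable_funeM (j%:R^-1%:E)); congr measurable_fun; apply/funext => mu.
rewrite (_ : _ `&` B = level mu j); last first.
  by rewrite ysectionE; apply/seteqP; split => x; [case|move=> xj; split => //; case: xj].
rewrite lfm_level// muleA -EFinM mulVf ?mul1e// pnatr_eq0.
by rewrite -lt0n.
Qed.

Lemma natoms_sum mu A : (natoms mu A)%:R%:E =
  \sum_(j <oo | j \in A `&` [set j | (0 < j)%N]) number_of_atoms mu B j.
Proof.
rewrite -multiplicitiesE nneseries_esum; last by move=> j _; exact: number_of_atoms_ge0.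
by rewrite set_mem_set.
Qed.

Lemma measurable_natoms A :
  measurable_fun setT (fun mu : borel M => (natoms (mu : M) A)%:R%:E : \bar R).
Proof.
under eq_fun do rewrite natoms_sum.
apply: ge0_emeasurable_sum => [j mu _ _|j]; first exact: number_of_atoms_ge0.
by rewrite inE => -[_ j0]; exact: measurable_number_of_atoms.
Qed.

(** One more unit at a point of mass [j] replaces a point of mass [j] by a point
    of mass [j.+1]; points of mass 0 are not counted, hence the restriction to
    positive integers on the left only. The terms are arranged so that no
    subtraction occurs. *)
Lemma natoms_add_dirac mu A x j : B x -> mu [set x] = j%:R%:E ->
  (natoms (lfm_add mu (lfm_dirac x)) A + (j \in A `&` [set j | (0 < j)%N])
   = natoms mu A + (j.+1 \in A))%N.
Proof.
move=> Bx muxj; set mu' := lfm_add mu _.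
have mu'E y : mu' [set y] = mu [set y] + (\1_[set y] x)%:E.
  by rewrite [LHS]measure_addE.
have inE (nu : M) y : (y \in fset_set (atoms_with nu A)) = (y \in atoms_with nu A).
  by rewrite in_fset_set//; exact: finite_atoms_with.
rewrite /natoms (cardfsD1 x) [in RHS](cardfsD1 x).
have -> : (fset_set (atoms_with mu A) `\ x = fset_set (atoms_with mu' A) `\ x)%fset.
  apply/fsetP => y; rewrite !in_fsetD1 !inE; have [//|/eqP yx] := eqVneq y x.
  apply/idP/idP => /set_mem[i iA [By yi]]; apply/mem_set; exists i => //; split=> //.
    by rewrite mu'E yi indicE memNset ?adde0//; exact: nesym.
  by rewrite -yi mu'E indicE memNset ?adde0//; exact: nesym.
have levE (nu : M) i : nu [set x] = i%:R%:E ->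
    (x \in atoms_with nu A) = (i \in A `&` [set j | (0 < j)%N]).
  move=> nui; apply/idP/idP => /set_mem; last by move=> iA; apply/mem_set; exists i.
  move=> [k kA [_]]; rewrite nui => -[/eqP]; rewrite eqr_nat => /eqP ->.
  exact/mem_set.
rewrite !inE (levE mu j)// (levE mu' j.+1); last first.
  by rewrite mu'E muxj indicE mem_set//= -EFinD (natr1 j).
have -> : (j.+1 \in A `&` [set j | (0 < j)%N]) = (j.+1 \in A).
  by apply/idP/idP => /set_mem; [case=> ? _; exact/mem_set|move=> ?; apply/mem_set].
by lia.
Qed.

(** Prescribed counts are integers rather than naturals: the recursions below
    shift them, and an event with a negative count is empty. *)
Definition counts_eq (l : seq (set nat * int)) : set M :=
  [set mu | all (fun p => (natoms mu p.1)%:Z == p.2) l].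

Lemma measurable_counts_eq l : measurable (counts_eq l : set (borel M)).
Proof.
elim: l => [|[A k] l IH]; first by rewrite (_ : counts_eq _ = setT)//; apply/seteqP.
rewrite (_ : counts_eq _ =
  [set mu : borel M | (natoms (mu : M) A)%:Z = k] `&` counts_eq l); last first.
  apply/seteqP; split => mu /=; first by move=> /andP[/eqP].
  by move=> [/eqP h1 h2]; apply/andP.
apply: measurableI => //.
case: k => n; last first.
  rewrite (_ : mkset _ = set0); first exact: measurable0.
  by apply/seteqP; split.
rewrite (_ : mkset _ = setT `&`
    (fun mu : borel M => (natoms (mu : M) A)%:R%:E : \bar R) @^-1` [set n%:R%:E]).
  by apply: measurable_natoms => //; exact: emeasurable_set1.
rewrite setTI; apply/seteqP; split => mu /= => [[->]//|[/eqP]].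
by rewrite eqr_nat => /eqP ->.
Qed.

End level_sets.

(** * The Mecke equation for the counts *)

Section mecke_equation.
Context (R : realType) (X : completeMetricType R).
Local Open Scope ereal_scope.
Local Notation M := (lfmeasure X).
Hypothesis sepX : separable X.
Variable B : set X.
Hypotheses (mB : measurable (B : set (borel X))) (bB : metric_bounded B).
Implicit Types (mu kappa : M) (j : nat) (l : seq (set nat * int)).

Let measurable_counts_eq l : measurable (counts_eq B l : set (borel M)).
Proof. exact: (measurable_counts_eq sepX mB bB). Qed.

Let measurable_level mu j : measurable (level B mu j : set (borel X)).
Proof. exact: (measurable_level sepX mB). Qed.

Lemma diffuse_finite_set kappa (F : set X) : diffuse kappa -> finite_set F ->
  kappa F = 0.
Proof.
move=> dk fF; rewrite -(fset_setK fF) lfm_fset big1// => x _; exact: dk.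
Qed.

(** The points of [B] with positive mass are countably many, as those of mass at
    least 1/n are finitely many; a diffuse measure does not see them. *)
Lemma diffuse_level0 kappa mu : diffuse kappa -> kappa (level B mu 0) = kappa B.
Proof.
move=> dk; have ml := measurable_level mu 0.
have mD : measurable (B `\` level B mu 0 : set (borel X)) by exact: measurableD.
rewrite [RHS](@measureDI _ (borel X) R kappa _ _ mB ml) [X in _ = X + _](_ : _ = 0).
  rewrite add0e; congr (kappa _); apply/seteqP; split => x; last by case.
  by move=> xl; split => //; case: xl.
apply/(@negligibleP _ (borel X) R kappa _ mD).
pose heavy n := [set x | B x /\ n.+1%:R^-1%:E <= mu [set x]].
have fh n : finite_set (heavy n).
  by apply: finite_heavy_points => //; rewrite invr_gt0.
apply: (@negligibleS _ (borel X) R kappa (\bigcup_n heavy n)); last first.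
  apply: negligible_bigcup => n; apply/negligibleP; last exact: diffuse_finite_set.
  apply: countable_measurable; [exact: borel_set1|exact: finite_set_countable].
move=> x [Bx nlx]; have : 0 < mu [set x].
  by rewrite lt0e measure_ge0 andbT; apply/eqP => mx; apply: nlx.
case mx : (mu [set x]) => [r| |//]; last by exists 0%N => //; split => //; rewrite mx leey.
rewrite lte_fin => r0; have [n _] := near_infty_natSinv_lt (PosNum r0).
move=> /(_ n (leqnn n))/= nr; exists n => //; split => //.
by rewrite mx lee_fin ltW.
Qed.

(** The counts before a point of mass [j] is added, given those after. *)
Definition shift_counts j l : seq (set nat * int) :=
  [seq (p.1, (p.2 - (j \in p.1)%:Z)%R) | p <- l].

(** The counts before a point of mass [j] grows to mass [j.+1], given those
    after. *)
Let pull_counts j l : seq (set nat * int) :=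
  [seq (p.1, (p.2 - (j.+1 \in p.1)%:Z + (j \in p.1 `&` [set i | (0 < i)%N])%:Z)%R)
  | p <- l].

Let counts_eq_add_dirac mu x j l : level B mu j x ->
  counts_eq B l (lfm_add mu (lfm_dirac x)) <-> counts_eq B (pull_counts j l) mu.
Proof.
move=> [Bx mx]; rewrite /counts_eq/= /pull_counts all_map.
suff /eq_all -> : (fun p : set nat * int =>
    (natoms B (lfm_add mu (lfm_dirac x)) p.1)%:Z == p.2) =1
  preim (fun p : set nat * int =>
    (p.1, (p.2 - (j.+1 \in p.1)%:Z + (j \in p.1 `&` [set i | (0 < i)%N])%:Z)%R))
   (fun p => (natoms B mu p.1)%:Z == p.2) by [].
move=> [A k]/=; have h := natoms_add_dirac mB bB A Bx mx.
by apply/eqP/eqP; lia.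
Qed.

Variables (z : R) (kappa : M) (Q : {measure set (borel M) -> \bar R}).
Hypotheses (z_ge0 : (0 <= z)%R) (dkappa : diffuse kappa)
  (polyaQ : polya_sum_law z kappa Q).

(** The integral equation applied to the indicator of the points of mass [j.+1]
    under measures with counts [l]. *)
Let polya_level j l :
  \int[Q]_(mu in counts_eq B l) (mu : M) (level B mu j.+1) =
  \int[Q]_(mu in counts_eq B (pull_counts j l))
     (z%:E * ((kappa (level B mu j) + (mu : M) (level B mu j)))).
Proof.
pose C := [set p : borel X * borel M | level B p.2 j.+1 p.1] `&`
  (snd @^-1` counts_eq B l).
have mC : measurable C.
  apply: measurableI; first exact: (measurable_level_graph sepX mB).
  by rewrite -[X in measurable X]setTI; apply: measurable_snd.
pose h (p : borel X * borel M) : \bar R := (\1_C p)%:E.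
have mh : measurable_fun setT h by apply/measurable_EFinP; exact: measurable_indic.
have h0 p : 0 <= h p by rewrite lee_fin.
have [_ _ /(_ h mh h0)] := polyaQ.
have integral_ind (nu : M) (f : X -> \bar R) (D : set X) (b : Prop) :
    measurable (D : set (borel X)) ->
    (forall x, f x = ((x \in D) && `[<b>])%:R%:E) ->
    \int[nu]_x f x = if `[<b>] then nu D else 0.
  move=> mD fE; case: ifPn => [hb|/negbTE hb].
    rewrite -[in RHS](setIT D) -integral_indic//.
    by apply: eq_integral => x _; rewrite fE hb andbT indicE.
  by under eq_integral do rewrite fE hb andbF; rewrite integral0.
have -> : (fun mu : borel M => \int[(mu : M)]_x h (x, mu)) =
    ((fun mu : borel M => (mu : M) (level B mu j.+1)) \_ (counts_eq B l)).
  apply/funext => mu; rewrite (integral_ind _ _ (level B mu j.+1) (counts_eq B l mu))//.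
  move=> x; rewrite /h indicE; congr ((nat_of_bool _)%:R%:E); apply/idP/andP.
    by move=> /set_mem[/= xl lmu]; split; [exact/mem_set|exact/asboolP].
  by move=> [/set_mem xl /asboolP lmu]; exact/mem_set.
rewrite -integral_mkcond => ->; rewrite [RHS]integral_mkcond.
apply: eq_integral => mu _.
rewrite (integral_ind _ _ (level B mu j) (counts_eq B (pull_counts j l) mu))//.
  rewrite patchE; case: asboolP => lmu.
    by rewrite mem_set//; congr (_ * _); exact: measure_addE.
  by rewrite memNset// mule0.
move=> x; rewrite /h indicE; congr ((nat_of_bool _)%:R%:E).
have muxE : lfm_add mu (lfm_dirac x) [set x] = (mu : M) [set x] + 1.
  by rewrite [LHS]measure_addE /= diracE mem_set.
have lE : level B (lfm_add mu (lfm_dirac x)) j.+1 x <-> level B mu j x.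
  split=> -[Bx].
    rewrite [X in X = _]muxE => e; split => //; move: e.
    case: (mu _) => [r| |]//=; rewrite -EFinD -(natr1 j) => -[/addIr ->]//.
  by move=> mx; split => //; rewrite [X in X = _]muxE mx -EFinD natr1.
apply/idP/andP.
  move=> /set_mem[/= /lE xl lmu]; split; first exact/mem_set.
  by apply/asboolP; apply/(counts_eq_add_dirac _ xl).
move=> [/set_mem xl /asboolP lmu]; apply/mem_set; split; first exact/lE.
exact/(counts_eq_add_dirac _ xl).
Qed.

(** Induction on [j]: for [j] = 1 the measure [kappa] creates the point, and [mu]
    almost surely does not charge points without mass; for larger [j] only [mu]
    charges the points of mass [j.-1], and the growth of such a point followed by
    the shift for [j.-1] amounts to the shift for [j]. *)
Lemma mecke_counts j l : (0 < j)%N ->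
  \int[Q]_(mu in counts_eq B l) number_of_atoms (mu : M) B j =
  kappa B * (z ^+ j / j%:R)%:E * Q (counts_eq B (shift_counts j l)).
Proof.
case: j => // j _.
have natE i l' : \int[Q]_(mu in counts_eq B l') (mu : M) (level B mu i.+1) =
    i.+1%:R%:E * \int[Q]_(mu in counts_eq B l') number_of_atoms (mu : M) B i.+1.
  rewrite -ge0_integralZl//.
  - by apply: eq_integral => mu _; rewrite (lfm_level mB bB).
  - apply: measurable_funTS.
    exact: (measurable_number_of_atoms sepX mB bB).
  - by move=> mu _; exact: number_of_atoms_ge0.
have kB : kappa B \is a fin_num by rewrite ge0_fin_numE//; exact: lfm_finite.
suff H : j.+1%:R%:E * \int[Q]_(mu in counts_eq B l) number_of_atoms (mu : M) B j.+1 =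
    kappa B * (z ^+ j.+1)%:E * Q (counts_eq B (shift_counts j.+1 l)).
  rewrite mulrC EFinM muleCA -muleA -H muleA -EFinM mulVf ?mul1e//.
elim: j l => [|j IH] l; rewrite -natE polya_level.
  have -> : pull_counts 0 l = shift_counts 1 l.
    apply: eq_map => -[A k] /=; rewrite (_ : (0%N \in _) = false) ?addr0//.
    by apply/negP => /set_mem[].
  have m0 : measurable_fun setT (fun mu : borel M => (mu : M) (level B mu 0)).
    have := @measurable_lfm_section R X _ B (measurable_level_graph sepX mB 0) mB bB.
    congr measurable_fun; apply/funext => mu; congr (_ _); rewrite ysectionE.
    by apply/seteqP; split => x; [case|move=> xj; split => //; case: xj].
  rewrite (@ae_eq_integral _ _ _ Q _ (cst (z%:E * kappa B)))//.
  - by rewrite integral_cst// expr1 [z%:E * _]muleC.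
  - apply: measurable_funeM; apply: measurable_funTS.
    under eq_fun do rewrite diffuse_level0//.
    exact: emeasurable_funD.
  - have [_ [N [mN QN0 notN]] _] := polyaQ; exists N; split => // mu.
    move=> /= nmu; apply: notN => /= pmu; apply: nmu => _.
    rewrite diffuse_level0// (point_measure_diffuse_part sepX pmu) ?adde0//.
    by move=> x [].
rewrite (_ : shift_counts _ _ = shift_counts j.+1 (pull_counts j.+1 l)); last first.
  rewrite /shift_counts /pull_counts -map_comp; apply: eq_map => -[A k] /=.
  congr pair; rewrite (_ : (_ \in _ `&` _) = (j.+1 \in A)) ?addrK//.
  by apply/idP/idP => /set_mem; [case=> ? _; exact/mem_set|move=> ?; apply/mem_set].
transitivity (z%:E * \int[Q]_(mu in counts_eq B (pull_counts j.+1 l))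
    (mu : M) (level B mu j.+1)).
  rewrite -ge0_integralZl//.
  - apply: eq_integral => mu _; rewrite diffuse_finite_set ?add0e//.
    exact: finite_level.
  - apply: measurable_funTS.
    under eq_fun do rewrite (lfm_level mB bB)//.
    apply: measurable_funeM; exact: (measurable_number_of_atoms sepX mB bB).
by rewrite natE IH muleA muleCA -EFinM -exprS.
Qed.

End mecke_equation.

(** * From the Mecke equation to independent Poisson counts *)

Section poisson_from_mecke.
Context (R : realType) (X : completeMetricType R).
Local Open Scope ereal_scope.
Local Notation M := (lfmeasure X).
Hypothesis sepX : separable X.
Variable B : set X.
Hypotheses (mB : measurable (B : set (borel X))) (bB : metric_bounded B).
Implicit Types (A : set nat) (l : seq (set nat * int)) (s : seq (set nat * nat)).

Let measurable_counts_eq l : measurable (counts_eq B l : set (borel M)).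
Proof. exact: (measurable_counts_eq sepX mB bB). Qed.

Variables (Q : {measure set (borel M) -> \bar R}) (w : nat -> R).
Hypotheses (QT : Q setT = 1) (w_ge0 : forall j, (0 <= w j)%R).
Hypothesis mecke : forall j l, (0 < j)%N ->
  \int[Q]_(mu in counts_eq B l) number_of_atoms (mu : M) B j =
  (w j)%:E * Q (counts_eq B (shift_counts j l)).

Definition total_weight A : \bar R :=
  \sum_(j <oo | j \in A `&` [set j | (0 < j)%N]) (w j)%:E.

Hypothesis total_weight_fin : forall A, total_weight A \is a fin_num.

Let disjoint_counts A l := all (fun p : set nat * int => `[< A `&` p.1 = set0 >]) l.

Let Qfin l : Q (counts_eq B l) \is a fin_num.
Proof.
rewrite ge0_fin_numE// (@le_lt_trans _ _ 1) ?ltry//.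
by rewrite -QT; apply: le_measure; rewrite ?inE.
Qed.

Let counts_eq_cons (mu : M) A (k : int) l :
  counts_eq B ((A, k) :: l) mu <-> (natoms B mu A)%:Z = k /\ counts_eq B l mu.
Proof. by split=> [/= /andP[/eqP]//|/= [/eqP ? ?]]; apply/andP. Qed.

(** Sum the Mecke equation over [j] in [A]: such a [j] lowers the count of [A] and
    leaves the other counts alone, by disjointness. *)
Let count_recursion A (k : nat) l : disjoint_counts A l ->
  k%:R%:E * Q (counts_eq B ((A, k%:Z) :: l)) =
  total_weight A * Q (counts_eq B ((A, (k%:Z - 1)%R) :: l)).
Proof.
move=> dA; set E := counts_eq B ((A, k%:Z) :: l).
have mE : measurable (E : set (borel M)) by exact: measurable_counts_eq.
transitivity (\int[Q]_(mu in E) (natoms B (mu : M) A)%:R%:E).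
  rewrite -integral_cst//; apply: eq_integral => mu; rewrite inE.
  by move=> /counts_eq_cons[[->]].
under eq_integral do rewrite (natoms_sum sepX mB bB) eseries_mkcond.
rewrite integral_nneseries//; last 2 first.
- move=> j; apply: measurable_funTS.
  have [/set_mem[_ j0]|_] := boolP (j \in A `&` [set j | (0 < j)%N]); last first.
    exact: measurable_cst.
  exact: (measurable_number_of_atoms sepX mB bB).
- by move=> j mu _; case: ifPn => // _; exact: number_of_atoms_ge0.
rewrite muleC -[X in X * _]fineK// /total_weight -nneseriesZl; last first.
  by move=> j _; rewrite lee_fin.
rewrite [RHS]eseries_mkcond; apply: eq_eseriesr => j _.
case: ifPn => [|_]; last by rewrite integral0.
rewrite inE => -[Aj j0]; rewrite mecke// muleC fineK//; congr (Q (counts_eq B _) * _).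
rewrite /shift_counts/= mem_set//; congr cons.
rewrite -[RHS]map_id; apply/eq_in_map => -[A' k'] /(allP dA)/asboolP /= AA'.
rewrite (_ : (j \in A') = false) ?subr0//; apply/negP => /set_mem A'j.
by have : (A `&` A') j by []; rewrite AA'.
Qed.

Definition poisson_weight (r : R) (k : nat) : R := (r ^+ k / k`!%:R * expR (- r))%R.

Let series_poisson (r p : R) : (0 <= r)%R -> (0 <= p)%R ->
  \sum_(k <oo) (r ^+ k / k`!%:R * p)%:E = (expR r * p)%:E.
Proof.
move=> r0 p0; under eq_eseriesr do rewrite mulrC EFinM.
rewrite nneseriesZl; last by move=> k _; rewrite lee_fin divr_ge0// exprn_ge0.
rewrite muleC EFinM; congr (_ * _); apply/cvg_lim => //.
under eq_cvg do rewrite sumEFin.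
by apply: cvg_EFin; [exact: nearW|exact: is_cvg_series_exp_coeff].
Qed.

(** The recursion gives the probabilities for all [k] in terms of the one for
    [k] = 0; summing over [k], which loses the condition on [A], determines the
    latter as the factor exp(-r). *)
Lemma counts_eq_cons_poisson A (k : nat) l : disjoint_counts A l ->
  Q (counts_eq B ((A, k%:Z) :: l)) =
  (poisson_weight (fine (total_weight A)) k)%:E * Q (counts_eq B l).
Proof.
move=> dA; set r := fine (total_weight A).
have rE : total_weight A = r%:E by rewrite fineK.
have r0 : (0 <= r)%R.
  by rewrite fine_ge0//; apply: nneseries_ge0 => j _ _; rewrite lee_fin.
pose p k := fine (Q (counts_eq B ((A, k%:Z) :: l))).
have pE n : Q (counts_eq B ((A, n%:Z) :: l)) = (p n)%:E by rewrite fineK.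
have p0 n : (0 <= p n)%R by rewrite fine_ge0.
have rec n : p n = (r ^+ n / n`!%:R * p 0%N)%R.
  elim: n => [|n IH]; first by rewrite expr0 fact0 divr1 mul1r.
  have := count_recursion n.+1 dA.
  rewrite (_ : n.+1%:Z - 1 = n%:Z)%R; last by lia.
  rewrite !pE rE -!EFinM => -[]; rewrite IH => H.
  rewrite factS natrM exprS; move: H.
  have n0 : n.+1%:R != 0%R :> R by rewrite pnatr_eq0.
  move=> /(congr1 ( *%R n.+1%:R^-1)); rewrite mulrA mulVf// mul1r => ->.
  by rewrite invfM; ring.
have total : Q (counts_eq B l) = (expR r * p 0%N)%:E.
  rewrite -series_poisson//.
  transitivity (\sum_(n <oo) Q (counts_eq B ((A, n%:Z) :: l))).
    rewrite -measure_semi_bigcup//.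
    - congr (Q _); apply/seteqP; split => [mu lmu|mu [n _ /counts_eq_cons[]]//].
      by exists (natoms B mu A) => //; apply/counts_eq_cons.
    - move=> m n _ _ [mu [/counts_eq_cons[mE _] /counts_eq_cons[nE _]]].
      by move: nE; rewrite mE => -[].
    - by apply: bigcup_measurable => n _; exact: measurable_counts_eq.
  by apply: eq_eseriesr => n _; rewrite pE rec.
rewrite pE total -EFinM rec /poisson_weight; congr EFin.
by rewrite -[LHS]mulr1 -(expRxMexpNx_1 r); ring.
Qed.

Lemma counts_eq_poisson s :
  pairwise (fun p q : set nat * nat => `[< p.1 `&` q.1 = set0 >]) s ->
  Q (counts_eq B [seq (p.1, p.2%:Z) | p <- s]) =
  \prod_(p <- s) (poisson_weight (fine (total_weight p.1)) p.2)%:E.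
Proof.
elim: s => [_|[A k] s IH /= /andP[dA ps]].
  by rewrite big_nil -QT; congr (Q _); apply/seteqP.
rewrite big_cons counts_eq_cons_poisson ?IH// /disjoint_counts all_map.
exact: dA.
Qed.

End poisson_from_mecke.

(** * The law of the process at a fixed time *)

Section law_of_the_process.
Context (R : realType) (X : completeMetricType R).
Local Open Scope ereal_scope.
Local Notation M := (lfmeasure X).
Implicit Types (mu nu : M).

Lemma measure_eq_lfm_pairing mu nu : measure_eq mu nu -> lfm_pairing mu = lfm_pairing nu.
Proof.
move=> munu; apply/funext => f; rewrite /lfm_pairing /Rintegral.
by congr fine; apply: eq_measure_integral => A mA _; exact: munu.
Qed.

(** Open sets of the vague topology are defined through integrals, so Borel sets
    cannot separate two measures that agree on measurable sets. *)
Lemma measure_eq_borel mu nu (A : set (borel M)) : measurable A ->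
  measure_eq mu nu -> A mu -> A nu.
Proof.
move=> mA munu; suff : [set A : set M | A mu <-> A nu] A by move=> [].
move: A mA; apply: smallest_sub.
  split => [|A|F]; rewrite /mkset.
  - by [].
  - by move=> AE; rewrite setTD; split => ? /AE.
  - by move=> FE; split=> -[n _ /FE Fn]; exists n.
by move=> _ [V _ <-]; rewrite /mkset /preimage /mkset (measure_eq_lfm_pairing munu).
Qed.

Lemma measure_eq_lfm0 mu : measure_eq mu (lfm0 X) <-> mu setT = 0.
Proof.
split=> [->//|muT A mA]; rewrite [RHS]/=.
by apply/eqP; rewrite -measure_le0 -muT; apply: le_measure; rewrite ?inE.
Qed.

Lemma measurable_null_lfm : measurable [set mu : borel M | (mu : M) setT = 0].
Proof.
have := @measurable_lfm R X _ measurableT measurableT _ (emeasurable_set1 0).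
by rewrite setTI.
Qed.

Lemma lfm_sub_null mu nu : mu setT = 0 -> measure_eq (lfm_sub nu mu) nu.
Proof.
move=> /measure_eq_lfm0 mu0.
have add0 xi A : measurable (A : set (borel X)) -> lfm_add mu xi A = xi A.
  by move=> mA; rewrite [LHS]measure_addE mu0//= add0e.
rewrite /lfm_sub; case: xgetP => [xi _ /= xinu|/(_ nu)[] A mA]; last exact: add0.
by move=> A mA; rewrite -xinu// add0.
Qed.

Context (d : measure_display) (Omega : measurableType d) (P : probability Omega R).
Variables (rho : M) (Y : R -> Omega -> M).
Hypothesis hY : spatial_crp P rho Y.

Let null0 : set Omega := Y 0%R @^-1` [set mu | mu setT = 0].

Let measurable_null0 : measurable null0.
Proof.
rewrite -[null0]setTI; apply: (crp_measurable hY) => //.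
exact: measurable_null_lfm.
Qed.

Let setI_null0 (S : set Omega) : measurable S -> P (null0 `&` S) = P S.
Proof.
move=> mS; rewrite [RHS](@measureDI _ _ _ P S null0)//.
rewrite [X in _ = X + _](_ : _ = 0) ?add0e 1?setIC//.
apply/negligibleP; first exact: measurableD.
have [N [mN PN0 Nsub]] := crp_init hY.
exists N; split => // w [_ nw]; apply: Nsub => /= /measure_eq_lfm0 Y0.
by apply: nw.
Qed.

(** The conditional law is taken at time 0 on the event that [Y 0] is null, where
    the increment agrees with [Y t]. Restricting to this event makes the preimage
    under the increment equal to one under [Y t], hence measurable. On this event
    the kernel has the same value as at the zero measure, because it is a
    measurable function of its argument. *)
Lemma crp_law (t : R) : (0 < t)%R -> (t < 1)%R ->
  exists Q : {measure set (borel M) -> \bar R},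
    [/\ Q setT = 1, polya_sum_law t (lfm_add rho (lfm0 X)) Q &
      forall A : set (borel M), measurable A -> P (Y t @^-1` A) = Q A].
Proof.
move=> t0 t1; have [K [polyaK condK]] := crp_increment hY (lexx 0%R) t0 t1.
have pm0 : point_measure (lfm0 X) by move=> A _ _; exists 0%N.
exists (K (lfm0 X)); split.
- exact: prob_kernel.
- by have := polyaK _ pm0; rewrite !subr0 divr1.
move=> A mA.
have mYt : measurable (Y t @^-1` A).
  by rewrite -[X in measurable X]setTI; apply: (crp_measurable hY) => //; exact: ltW.
rewrite -setI_null0//.
have -> : null0 `&` Y t @^-1` A =
    Y 0%R @^-1` [set mu | mu setT = 0] `&`
    (fun w => lfm_sub (Y t w) (Y 0%R w)) @^-1` A.
  apply/seteqP; split => w [/= Y0 YA]; split => //.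
    apply: (measure_eq_borel mA _ YA) => S mS.
    by rewrite lfm_sub_null.
  by apply: (measure_eq_borel mA _ YA); exact: lfm_sub_null.
rewrite [LHS](condK [set mu : borel M | (mu : M) setT = 0])//; last first.
  exact: measurable_null_lfm.
(* a level set of the kernel is Borel, so it does not separate Y 0 w from 0 *)
transitivity (\int[P]_(w in null0) (K (lfm0 X) A)).
  apply: eq_integral => w /set_mem /= /measure_eq_lfm0 Y0.
  have mK : measurable [set mu : borel M | K mu A = K (lfm0 X) A].
    have := measurable_kernel K A mA measurableT _ (emeasurable_set1 (K (lfm0 X) A)).
    by rewrite setTI.
  apply: (measure_eq_borel mK (mu := lfm0 X)) => // S mS.
  by rewrite Y0.
have := setI_null0 measurableT; rewrite setIT probability_setT => P1.
by rewrite integral_cst// [X in _ * X]P1 mule1.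
Qed.

Lemma crp_law0 (A : set (borel M)) : measurable A ->
  P (Y 0%R @^-1` A) = \d_(lfm0 X : borel M) A.
Proof.
move=> mA; have mY : measurable (Y 0%R @^-1` A).
  by rewrite -[X in measurable X]setTI; apply: (crp_measurable hY).
rewrite -setI_null0// diracE; case: (boolP (_ \in A)) => [/set_mem A0|/negP nA0].
  rewrite (_ : _ `&` _ = null0 `&` setT) ?setI_null0 ?probability_setT//.
  apply/seteqP; split => w [Y0 _]; split => //.
  by apply: (measure_eq_borel mA _ A0) => S mS; rewrite (proj2 (measure_eq_lfm0 _) Y0).
rewrite (_ : _ `&` _ = set0) ?measure0//.
apply/seteqP; split => w //= [Y0 YA]; apply: nA0; apply/mem_set.
by apply: (measure_eq_borel mA _ YA); exact/measure_eq_lfm0.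
Qed.

End law_of_the_process.

(** * The Poisson process of multiplicities *)

Section multiplicity_law.
Context (R : realType) (X : completeMetricType R).
Local Open Scope ereal_scope.
Local Notation M := (lfmeasure X).
Implicit Types (mu kappa rho : M) (B : set X).

Definition crp_rate rho B (t : R) (j : nat) : R := (fine (rho B) * (t ^+ j / j%:R))%R.

Lemma crp_rate_ge0 rho B t j : (0 <= t)%R -> (0 <= crp_rate rho B t j)%R.
Proof. by move=> t0; rewrite mulr_ge0 ?fine_ge0// divr_ge0// exprn_ge0. Qed.

Lemma crp_intensityE rho B (t : R) (t0 : (0 <= t)%R) (A : set nat) :
  measurable (B : set (borel X)) -> metric_bounded B ->
  crp_intensity rho B t0 A = total_weight (crp_rate rho B t) A.
Proof.
move=> mB bB; rewrite /total_weight nneseries_esum; last first.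
  by move=> j _; rewrite lee_fin crp_rate_ge0.
rewrite set_mem_set; apply: eq_esum => j _; rewrite /crp_rate [RHS]EFinM fineK//.
by rewrite ge0_fin_numE//; exact: lfm_finite.
Qed.

Lemma crp_total_weight_fin rho B (t : R) (A : set nat) :
  (0 <= t)%R -> (t < 1)%R -> total_weight (crp_rate rho B t) A \is a fin_num.
Proof.
move=> t0 t1; rewrite ge0_fin_numE; last first.
  by apply: nneseries_ge0 => j _ _; rewrite lee_fin crp_rate_ge0.
rewrite /total_weight eseries_mkcond.
pose g := geometric (fine (rho B)) t.
have g0 j : (0 <= g j)%R by rewrite mulr_ge0 ?fine_ge0// exprn_ge0.
apply: (@le_lt_trans _ _ (\sum_(j <oo) (g j)%:E)).
  apply: lee_nneseries => j _ //.
    by case: ifP => // _; rewrite lee_fin crp_rate_ge0.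
  case: ifPn => [/set_mem[_ /= j0]|_]; last by rewrite lee_fin.
  rewrite lee_fin ler_wpM2l ?fine_ge0// ler_pdivrMr ?ltr0n//.
  by rewrite ler_peMr ?exprn_ge0// ler1n.
have : (fun n => \sum_(0 <= j < n) (g j)%:E) @ \oo --> (limn (series g))%:E.
  under eq_cvg do rewrite sumEFin.
  apply: cvg_EFin; [exact: nearW|apply: is_cvg_geometric_series].
  by rewrite ger0_norm.
by move=> /cvg_lim ->//; exact: ltry.
Qed.

(** Time 0, which the law of increments does not cover: there are no atoms, and
    the rates vanish. *)
Lemma mecke_dirac0 rho B (sepX : separable X) (mB : measurable (B : set (borel X)))
    (bB : metric_bounded B) j (l : seq (set nat * int)) : (0 < j)%N ->
  \int[\d_(lfm0 X : borel M)]_(mu in counts_eq B l) number_of_atoms (mu : M) B j =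
  (crp_rate rho B 0 j)%:E * \d_(lfm0 X : borel M) (counts_eq B (shift_counts j l)).
Proof.
move=> j0; rewrite /crp_rate expr0n -[(j == 0)%N]negbK -lt0n j0 mul0r mulr0 mul0e.
rewrite integral_mkcond integral_dirac//; last first.
  apply/(measurable_restrictT _ (measurable_counts_eq sepX mB bB l)).
  by apply: measurable_funTS; exact: (measurable_number_of_atoms sepX mB bB).
rewrite patchE; case: ifP => _; rewrite ?mule0//.
rewrite /number_of_atoms (_ : mkset _ = set0) ?measure0 ?mule0//.
  by rewrite /counting asboolT// fset_set0 mule0.
apply/seteqP; split => // x [_ /eqP].
by rewrite eq_sym eqe pnatr_eq0 -[(j == 0)%N]negbK -lt0n j0.
Qed.

End multiplicity_law.

Theorem lemma4p1 (R : realType) (X : completeMetricType R) (sepX : separable X)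
    (rho : lfmeasure X) (rho_diffuse : diffuse rho)
    (d : measure_display) (Omega : measurableType d) (P : probability Omega R)
    (Y : R -> Omega -> lfmeasure X) (hY : spatial_crp P rho Y)
    (B : set X) (mB : measurable (B : set (borel X))) (bB : metric_bounded B)
    (t : R) (t_ge0 : 0 <= t) (t_lt1 : t < 1) :
  finite_poisson_process P
    (fun w : Omega => multiplicities (Y t w) B) (crp_intensity rho B t_ge0).
Proof.
have mcounts l := measurable_counts_eq sepX mB bB l.
have [Q [QT meckeQ lawQ]] : exists Q : {measure set (borel (lfmeasure X)) -> \bar R},
    [/\ Q setT = 1%E,
      forall j l, (0 < j)%N ->
        (\int[Q]_(mu in counts_eq B l) number_of_atoms (mu : lfmeasure X) B j =
        (crp_rate rho B t j)%:E * Q (counts_eq B (shift_counts j l)))%E &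
      forall A : set (borel (lfmeasure X)), measurable A -> P (Y t @^-1` A) = Q A].
  have [t0|t0] := eqVneq t 0.
    rewrite t0; exists \d_(lfm0 X : borel (lfmeasure X)); split.
    - by rewrite [LHS]diracE in_setT.
    - by move=> j l j0; exact: mecke_dirac0.
    - by move=> A; exact: (crp_law0 hY).
  have t_gt0 : 0 < t by rewrite lt0r t0.
  have [Q [QT polyaQ lawQ]] := crp_law hY t_gt0 t_lt1.
  exists Q; split => // j l j0.
  have rho0E A : lfm_add rho (lfm0 X) A = rho A.
    by rewrite [LHS]measure_addE /= /mzero adde0.
  rewrite (mecke_counts sepX mB bB t_ge0 _ polyaQ l j0); last first.
    by move=> x; rewrite rho0E.
  congr (_ * _)%E; rewrite rho0E /crp_rate [RHS]EFinM fineK//.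
  by rewrite ge0_fin_numE//; exact: lfm_finite.
have w0 j := crp_rate_ge0 rho B j t_ge0.
have wfin A := crp_total_weight_fin rho B A t_ge0 t_lt1.
have lawN (s : seq (set nat * nat)) :
    pairwise (fun p q : set nat * nat => `[< p.1 `&` q.1 = set0 >]) s ->
    P [set w | all (fun p : set nat * nat => natoms B (Y t w) p.1 == p.2) s] =
    (\prod_(p <- s) (poisson_weight (fine (crp_intensity rho B t_ge0 p.1)) p.2)%:E)%E.
  move=> ps; under eq_bigr do rewrite crp_intensityE//.
  rewrite -(counts_eq_poisson sepX mB bB QT w0 meckeQ wfin)// -lawQ//.
  congr (P _); apply/seteqP; split => w /= /allP sw; apply/allP.
    by move=> _ /mapP[p ps' ->] /=; rewrite eqz_nat sw.
  by move=> p ps'; rewrite -eqz_nat (sw (p.1, p.2%:Z))//; exact: (map_f _ ps').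
have eqN w A k : (multiplicities (Y t w) B A = k%:R%:E)%E <-> natoms B (Y t w) A = k.
  rewrite (multiplicitiesE sepX mB bB); split => [[/eqP]|->//].
  by rewrite eqr_nat => /eqP.
have lawN1 A k : P [set w | multiplicities (Y t w) B A = k%:R%:E] =
    (poisson_weight (fine (crp_intensity rho B t_ge0 A)) k)%:E.
  have := lawN [:: (A, k)] isT; rewrite big_seq1 => <-.
  congr (P _); apply/seteqP; split => w /=; rewrite andbT.
    by move=> /eqN ->.
  by move=> /eqP kE; exact/eqN.
split.
- by rewrite crp_intensityE// ltey; have := wfin setT; rewrite fin_numE => /andP[].
- by move=> w A _; exists (natoms B (Y t w) A); exact: (multiplicitiesE sepX mB bB).
- move=> A _; under eq_fun do rewrite (multiplicitiesE sepX mB bB).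
  apply: (measurableT_comp (measurable_natoms sepX mB bB A)).
  exact: (crp_measurable hY).
- by move=> A k _; exact: lawN1.
move=> n A k _ tA.
under eq_bigr do rewrite lawN1.
have := lawN [seq (A i, k i) | i <- enum 'I_n]; rewrite big_map big_enum/= => <-.
  congr (P _); apply/seteqP; split => w /=.
    by move=> Nw; apply/allP => _ /mapP[i _ ->]/=; apply/eqP/eqN/Nw.
  move=> /allP Nw i _; apply/eqN/eqP; apply: (Nw (A i, k i)).
  by apply/mapP; exists i => //; rewrite mem_enum.
rewrite pairwise_map; have := enum_uniq 'I_n; rewrite uniq_pairwise.
apply: sub_pairwise => i j /= ij; apply/asboolP.
by move/trivIsetP : tA; apply.
Qed.
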